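(* Let $X$ be a PSCA$(v,t,\lambda)$, let $w,w'\in[v]$ with $w\neq w'$, and let $\boldsymbol{d}_w=(d_w(0),\dots,d_w(v-1))$ be the distribution vector of $w$ in $X$. Let $\boldsymbol{d}'_w=(d'_w(0),\dots,d'_w(v-2))$ be the distribution vector of $w$ in the PSCA $X'$ obtained by deleting the symbol $w'$ from (every permutation of) $X$. Then $$\delta_k=\sum_{i=0}^{k}\bigl(d'_w(i)-d_w(i)\bigr)$$ satisfies $0\le\delta_k\le d'_w(k)$ for $0\le k\le v-2$.
   Context: For positive integers $v\ge t$, let $[v]=\{0,\dots,v-1\}$, let $\mathcal{S}_v$ be the set of permutations of $[v]$ (bijections $[v]\to[v]$), and let $\mathcal{S}_{v,t}$ be the set of ordered sequences of $t$ distinct elements of $[v]$. A sequence $s=(s_0,\dots,s_{t-1})\in\mathcal{S}_{v,t}$ is covered by $\pi\in\mathcal{S}_v$ if $\pi^{-1}(s_i)<\pi^{-1}(s_{i+1})$ for $0\le i\le t-2$. For a positive integer $\lambda$, a PSCA$(v,t,\lambda)$ is a multiset $X$ of permutations in $\mathcal{S}_v$ such that every sequence in $\mathcal{S}_{v,t}$ is covered by exactly $\lambda$ permutations in $X$ (counted with multiplicity). The distribution vector of $w$ in a multiset $X$ of permutations of $[v]$ is $(d_w(0),\dots,d_w(v-1))$ with $d_w(i)=|\{\pi\in X:\pi(i)=w\}|$ (counted with multiplicity). Deleting the symbol $w'$: each permutation $\pi\in X$ is viewed as the word $\pi(0)\pi(1)\cdots\pi(v-1)$, the letter $w'$ is removed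 to give a word of length $v-1$ (positions $0,\dots,v-2$), and the remaining symbols are relabelled to $[v-1]$ in an order-preserving way. The vector $\boldsymbol{d}'_w$ refers to the (possibly relabelled) symbol $w$; i.e. $d'_w(i)$ is the number of resulting words (counted with multiplicity) in which the symbol originally called $w$ is at position $i$. *)

(* Defs.v *)
From mathcomp Require Import all_boot all_fingroup.

Set Implicit Arguments.
Unset Strict Implicit.
Unset Printing Implicit Defensive.

(* A multiset of permutations of [v] is a sequence over 'S_v : every notion
   below depends only on the multiplicities in the sequence, and deleting a
   symbol acts on it pointwise. *)

(* [sorted] compares consecutive entries, so this says that
   pi^-1 s_i < pi^-1 s_(i+1) for all 0 <= i <= t - 2. *)
Definition covered v (s : seq 'I_v) (pi : 'S_v) : bool :=
  sorted [rel x y | (pi^-1)%g x < (pi^-1)%g y] s.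

Definition is_PSCA v t (lambda : nat) (X : seq 'S_v) : Prop :=
  forall s : t.-tuple 'I_v, uniq s -> count (covered s) X = lambda.

Definition distribution v (X : seq 'S_v) (w : 'I_v) : {ffun 'I_v -> nat} :=
  [ffun i => count (fun pi : 'S_v => pi i == w) X].

Section Deletion.

Variables (v : nat) (w' : 'I_v).

(* [unlift w'] is None at w', and is the order-preserving bijection from
   [v] \ {w'} to [v-1] elsewhere. *)
Definition deleted_word (pi : 'S_v) : seq 'I_v.-1 :=
  pmap (unlift w') (codom pi).

Lemma map_lift_deleted_word pi :
  map (lift w') (deleted_word pi) = [seq x <- codom pi | x != w'].
Proof.
rewrite /deleted_word (@pmap_filter _ _ (unlift w') (lift w')).
  apply: eq_filter => x; rewrite /=.
  by case: unliftP => [j ->|->]; rewrite ?eqxx // eq_sym neq_lift.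
by move=> x; case: unliftP => [j ->|->].
Qed.

Lemma uniq_codom_perm (pi : 'S_v) : uniq (codom pi).
Proof. by rewrite map_inj_uniq ?enum_uniq //; apply: perm_inj. Qed.

Lemma size_deleted_word pi : size (deleted_word pi) == v.-1.
Proof.
rewrite -(size_map (lift w')) map_lift_deleted_word.
rewrite -(rem_filter _ (uniq_codom_perm pi)) size_rem ?size_codom ?card_ord //.
by apply/codomP; exists ((pi^-1)%g w'); rewrite permKV.
Qed.

Lemma uniq_deleted_word pi : uniq (deleted_word pi).
Proof.
rewrite -(map_inj_uniq (@lift_inj _ w')) map_lift_deleted_word.
exact/filter_uniq/uniq_codom_perm.
Qed.

Lemma deleted_word_inj pi : injective (tnth (Tuple (size_deleted_word pi))).
Proof. exact/tuple_uniqP/uniq_deleted_word. Qed.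

Definition delete (pi : 'S_v) : 'S_v.-1 := perm (@deleted_word_inj pi).

Definition relabel (w : 'I_v) (neq_ww' : w != w') : 'I_v.-1 :=
  s2val (unlift_some (contra_neq esym neq_ww')).

Lemma lift_relabel w (neq_ww' : w != w') : lift w' (relabel neq_ww') = w.
Proof. by rewrite -(s2valP (unlift_some (contra_neq esym neq_ww'))). Qed.

Lemma codom_delete pi : codom (delete pi) = deleted_word pi.
Proof.
rewrite /codom /image_mem (eq_map (permE (@deleted_word_inj pi))).
exact: (map_tnth_enum (Tuple (size_deleted_word pi))).
Qed.

Lemma covered_delete pi (s : seq 'I_v.-1) :
  covered s (delete pi) = covered (map (lift w') s) pi.
Proof.
have permV_index n (q : 'S_n) x : (q^-1)%g x = index x (codom q) :> nat.
  have -> : x = q ((q^-1)%g x) by rewrite permKV.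
  by rewrite permK (index_map (@perm_inj _ q)) index_enum_ord.
rewrite /covered sorted_map; apply: eq_sorted => x y /=.
rewrite !permV_index codom_delete /deleted_word.
elim: (codom pi) => //= z r IHr.
case: (unliftP w' z) => [j ->|->] /=; last first.
  by rewrite !(negPf (neq_lift _ _)) ltnS.
rewrite !(inj_eq (@lift_inj _ w')).
by case: (j == x); case: (j == y); rewrite ?ltnS.
Qed.

Lemma is_PSCA_delete t lambda X :
  is_PSCA t lambda X -> is_PSCA t lambda (map delete X).
Proof.
move=> PX s us; rewrite count_map -(PX (map_tuple (lift w') s)).
  by apply: eq_count => pi; rewrite /= covered_delete.
by rewrite map_inj_uniq //; apply: lift_inj.
Qed.

End Deletion.

(* Main.v *)
Require Import Defs.
From mathcomp Require Import all_boot all_order all_fingroup all_algebra.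

(** Both bounds come from comparing positions one word at a time. In a word
    [pi], let [p] be the position of [w] and [q] the one of [w']. Deleting [w'] moves [w] to [p' = p - (q < p)]
    ([delete_permV]), that is, one step to the left or not at all. Partial sums
    of a distribution vector count the words in which the symbol is at
    position at most [k] ([sum_count_eq]), so [delta k] is the number of words
    with [p' <= k] minus the number with [p <= k]. As [p' <= p], this is
    nonnegative; and a word with [p' <= k < p] must have [p' = k], so there are
    at most [d' k] of these. *)

Set Implicit Arguments.
Unset Strict Implicit.
Unset Printing Implicit Defensive.

Import Order.TTheory GRing.Theory Num.Theory.
Local Open Scope ring_scope.

Lemma permV_index n (q : 'S_n) x : (q^-1)%g x = index x (codom q) :> nat.
Proof.
have -> : x = q ((q^-1)%g x) by rewrite permKV.
by rewrite permK (index_map (@perm_inj _ q)) index_enum_ord.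
Qed.

(** Deleting [w'] lowers by one exactly the indices beyond that of [w']. The
    index of an absent symbol is the length of the word; the formula stays true
    with this value, which lets the induction pass the occurrence of [w']. *)
Lemma index_pmap_unlift n (w' : 'I_n) (x : 'I_n.-1) (s : seq 'I_n) :
  uniq s ->
  index x (pmap (unlift w') s) = unbump (index w' s) (index (lift w' x) s).
Proof.
elim: s => //= z s IHs /andP[z_s uniq_s]; have {}IHs := IHs uniq_s.
case: (unliftP w' z) z_s => [j ->|->] z_s /=.
  rewrite (inj_eq lift_inj) [lift w' j == w']eq_sym (negPf (neq_lift _ _)).
  case: (j == x) => //; rewrite IHs /unbump ltnS subSn //.
  by case: ltnP => //; apply: leq_trans.
(* [w'] has just been met, so its index in the tail is the length of the tail
   and the induction hypothesis gives no further shift. *)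
rewrite eqxx (negPf (neq_lift _ _)) IHs (memNindex z_s) /unbump.
by rewrite ltnNge index_size subn0 subn1.
Qed.

Lemma delete_permV n (w' : 'I_n) (pi : 'S_n) (x : 'I_n.-1) :
  ((delete w' pi)^-1)%g x
    = unbump ((pi^-1)%g w') ((pi^-1)%g (lift w' x)) :> nat.
Proof.
by rewrite !permV_index codom_delete index_pmap_unlift ?uniq_codom_perm.
Qed.

Lemma distribution_permV n (X : seq 'S_n) (w i : 'I_n) :
  distribution X w i = count (fun pi : 'S_n => (pi^-1)%g w == i :> nat) X.
Proof.
rewrite ffunE; apply: eq_count => pi /=.
by rewrite -[RHS](inj_eq (@perm_inj _ pi)) permKV eq_sym.
Qed.

Lemma sum_count_eq (T : Type) (f : T -> nat) (X : seq T) m (k : 'I_m) :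
  (\sum_(i < m | i <= k) count (fun x => f x == i) X
    = count (fun x => f x <= k) X)%N.
Proof.
elim: X => [|x X IHX] /=; first by rewrite big1.
rewrite big_split /= IHX; congr (_ + _)%N.
have [le_fk | lt_kf] := leqP (f x) k.
  have lt_fm := leq_ltn_trans le_fk (ltn_ord k).
  rewrite (bigD1 (Ordinal lt_fm)) //= eqxx big1 // => i /andP[_ ne_i].
  by rewrite eq_sym; move: ne_i; rewrite -val_eqE /= => /negPf->.
rewrite big1 // => i le_ik.
by rewrite (gtn_eqF (leq_ltn_trans le_ik lt_kf)).
Qed.

(** The word-by-word comparison behind both bounds: [g] is a position and [f]
    the same position after a shift to the left by at most one. *)
Lemma count_shift_bounds (T : Type) (f g : T -> nat) (X : seq T) (k : nat) :
    (forall x, f x <= g x <= (f x).+1)%N ->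
  (count (fun x => g x <= k) X <= count (fun x => f x <= k) X
     <= count (fun x => g x <= k) X + count (fun x => f x == k) X)%N.
Proof.
move=> fg; apply/andP; split.
  by apply: sub_count => x /=; case/andP: (fg x) => le_fg _; apply: leq_trans.
rewrite -count_predUI; apply: leq_trans (leq_addr _ _).
apply: sub_count => x /=; case/andP: (fg x) => _ le_gf.
by rewrite leq_eqVlt orbC => /orP[/(leq_trans le_gf)->|->]; rewrite ?orbT.
Qed.

Theorem theorem2p7 (v t lambda : nat) (t_gt0 : (0 < t)%N) (le_tv : (t <= v)%N)
    (lambda_gt0 : (0 < lambda)%N) (X : seq 'S_v) (PSCA_X : is_PSCA t lambda X)
    (w w' : 'I_v) (neq_ww' : w != w') :
  let d := distribution X w in
  let d' := distribution (map (delete w') X) (relabel neq_ww') in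
  let delta (k : 'I_v.-1) : int :=
    \sum_(i < v.-1 | (i <= k)%N)
       ((d' i)%:Z - (d (widen_ord (leq_pred v) i))%:Z) in
  forall k : 'I_v.-1, 0 <= delta k <= (d' k)%:Z.
Proof.
move=> d d' delta k.
pose g (pi : 'S_v) : nat := (pi^-1)%g w.
pose f (pi : 'S_v) : nat := ((delete w' pi)^-1)%g (relabel neq_ww').
have dE i : d (widen_ord (leq_pred v) i) = count (fun pi => g pi == i) X.
  exact: distribution_permV.
have d'E i : d' i = count (fun pi => f pi == i) X.
  by rewrite /d' distribution_permV count_map.
have fg pi : (f pi <= g pi <= (f pi).+1)%N.
  rewrite /f delete_permV lift_relabel -/(g pi) /unbump leq_subr -add1n.
  by rewrite -leq_subLR leq_sub2l ?leq_b1.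
have -> : delta k = (count (fun pi => f pi <= k)%N X)%:Z
                    - (count (fun pi => g pi <= k)%N X)%:Z.
  rewrite /delta sumrB -!sum_count_eq !(big_morph _ PoszD (erefl _)).
  by congr (_ - _); apply: eq_bigr => i _; rewrite ?d'E ?dE.
have /andP[le_gf le_fg] := count_shift_bounds X k fg.
by rewrite subr_ge0 lez_nat le_gf lerBlDl d'E -PoszD lez_nat.
Qed.
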